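(* Assume that $A_{\mathrm{ext}}$ is dissipative. Then the following assertions are equivalent for $\omega \in \mathbb{R}$ and $v \in H_1$: (i) $v \in \operatorname{dom}(A_S)$ and $A_S v = \mathrm{i}\omega v$; (ii) $\begin{pmatrix} v \\ 0 \end{pmatrix} \in \operatorname{dom}(A_{\mathrm{ext}})$ and $A_{\mathrm{ext}} \begin{pmatrix} v \\ 0 \end{pmatrix} = \mathrm{i}\omega \begin{pmatrix} v \\ 0 \end{pmatrix}$; (iii) $v \in \operatorname{dom}(A_{21})$ and $A_{21} v = 0$, as well as $\begin{pmatrix} v \\ 0 \end{pmatrix} \in \operatorname{dom}(A_1)$ and $A_1 \begin{pmatrix} v \\ 0 \end{pmatrix} = \mathrm{i}\omega v$. In particular, the point spectra (sets of eigenvalues) of $A_S$ and $A_{\mathrm{ext}}$ satisfy $\sigma_{\mathrm{pnt}}(A_S) \cap \mathrm{i}\mathbb{R} \subseteq \sigma_{\mathrm{pnt}}(A_{\mathrm{ext}}) \cap \mathrm{i}\mathbb{R}$.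
   Context: Inner products on complex Hilbert spaces are linear in the first and antilinear in the second component. Let $H_1, H_2$ be non-zero complex Hilbert spaces, let $A_1: \operatorname{dom}(A_1) \subseteq H_1 \times H_2 \to H_1$ and $A_{21}: \operatorname{dom}(A_{21}) \subseteq H_1 \to H_2$ be linear operators (defined on vector subspaces), and let $S: H_2 \to H_2$ be a bounded linear operator that is coercive: there is $\nu > 0$ with $\operatorname{Re}(h_2 | S h_2)_{H_2} \ge \nu \|h_2\|_{H_2}^2$ for all $h_2 \in H_2$. The operator $A_{\mathrm{ext}}$ on $H_1 \times H_2$ has domain $\operatorname{dom}(A_{\mathrm{ext}}) = \{ (h_1,h_2) \in \operatorname{dom}(A_1) : h_1 \in \operatorname{dom}(A_{21}) \}$ and acts as $A_{\mathrm{ext}}(h_1,h_2) = (A_1(h_1,h_2),\, A_{21}h_1)$. The operator $A_S$ on $H_1$ has domain $\operatorname{dom}(A_S) = \{ h_1 \in \operatorname{dom}(A_{21}) : (h_1, S A_{21} h_1) \in \operatorname{dom}(A_1) \}$ and acts as $A_S h_1 = A_1 (h_1, S A_{21} h_1)$. A linear operator $A$ on a complex Hilbert space is dissipative if $\operatorname{Re}(Ah | h) \le 0$ for all $h \in \operatorname{dom}(A)$. *)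

(* Defs.v *)
From HB Require Import structures.
From mathcomp Require Import all_boot all_order all_algebra.
From mathcomp Require Import complex.
From mathcomp Require Import all_classical all_reals all_analysis.

Set Implicit Arguments.
Unset Strict Implicit.
Unset Printing Implicit Defensive.

Import Order.TTheory GRing.Theory Num.Theory.
Import numFieldNormedType.Exports.

Local Open Scope classical_set_scope.
Local Open Scope ring_scope.
Local Open Scope complex_scope.

(* A form of type [{dot H for Num.conj}] is linear in its first and antilinear
   in its second argument. *)
HB.mixin Record NormedModule_isHilbert (R : realType) H
    of NormedModule R[i] H := {
  inner : {dot H for (@Num.conj R[i])} ;
  inner_norm : forall h : H, inner h h = `|h| ^+ 2
}.

#[short(type="hilbertType")]
HB.structure Definition Hilbert (R : realType) :=
  {H of CompleteNormedModule R[i] H & NormedModule_isHilbert R H}.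

(* [(H1 * H2)%type] carries the max norm in the library, which does not come
   from an inner product; this alias carries the norm and the inner product of
   the Hilbert space sum. *)
Definition hprod (R : realType) (H1 H2 : hilbertType R) : Type :=
  (H1 * H2)%type.

Section HilbertProduct.
Variables (R : realType) (H1 H2 : hilbertType R).

HB.instance Definition _ := GRing.Lmodule.copy (hprod H1 H2) (H1 * H2)%type.

Implicit Types (p q : hprod H1 H2).

Definition hprod_norm p : R[i] := sqrtC (`|p.1| ^+ 2 + `|p.2| ^+ 2).

Lemma hprod_norm_sqr p : hprod_norm p ^+ 2 = `|p.1| ^+ 2 + `|p.2| ^+ 2.
Proof. by rewrite sqrtCK. Qed.

Lemma hprod_normD p q : hprod_norm (p + q) <= hprod_norm p + hprod_norm q.
Proof.
have rect (x y : R[i]) : 0 <= x -> 0 <= y ->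
    sqrtC (x ^+ 2 + y ^+ 2) = `|x + Num.imaginary * y|.
  by move=> x0 y0; rewrite normC_rect ?ger0_real.
rewrite /hprod_norm.
apply: (@le_trans _ _ (sqrtC ((`|p.1| + `|q.1|) ^+ 2 +
                              (`|p.2| + `|q.2|) ^+ 2))).
  rewrite ler_sqrtC ?qualifE/= ?addr_ge0 ?exprn_ge0 ?addr_ge0//.
  by rewrite lerD// lerXn2r ?qualifE/= ?addr_ge0//; exact: ler_normD.
rewrite !rect ?addr_ge0//.
by rewrite mulrDr addrACA; exact: ler_normD.
Qed.

Lemma hprod_normZ (l : R[i]) p : hprod_norm (l *: p) = `|l| * hprod_norm p.
Proof.
rewrite /hprod_norm /= !normrZ !exprMn -mulrDr.
by rewrite rootCMl ?exprn_ge0 // sqrCK.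
Qed.

Lemma hprod_norm0_eq0 p : hprod_norm p = 0 -> p = 0.
Proof.
move=> /eqP; rewrite sqrtC_eq0 paddr_eq0 ?exprn_ge0//.
by rewrite !expf_eq0/= !normr_eq0; case: p => a b /= /andP[/eqP-> /eqP->].
Qed.

HB.instance Definition _ :=
  @Lmodule_isNormed.Build R[i] (hprod H1 H2) hprod_norm
    hprod_normD hprod_normZ hprod_norm0_eq0.

Lemma hprod_normE p : `|p| = hprod_norm p.
Proof. by []. Qed.

Lemma fst_le_hprod_norm p : `|p.1| <= `|p|.
Proof.
rewrite hprod_normE -[leLHS]sqrCK// ler_sqrtC ?qualifE/= ?addr_ge0 ?exprn_ge0//.
by rewrite lerDl exprn_ge0.
Qed.

Lemma snd_le_hprod_norm p : `|p.2| <= `|p|.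
Proof.
rewrite hprod_normE -[leLHS]sqrCK// ler_sqrtC ?qualifE/= ?addr_ge0 ?exprn_ge0//.
by rewrite lerDr exprn_ge0.
Qed.

Lemma hprod_norm_leD p : `|p| <= `|p.1| + `|p.2|.
Proof.
have s0 : 0 <= `|p.1| + `|p.2| by rewrite addr_ge0.
rewrite hprod_normE -[leRHS]sqrCK// ler_sqrtC ?qualifE/= ?addr_ge0 ?exprn_ge0//.
by rewrite sqrrD addrAC lerDl mulrn_wge0// mulr_ge0.
Qed.

Lemma hprod_complete (F : set_system (hprod H1 H2)) :
  ProperFilter F -> cauchy F -> cvg F.
Proof.
move=> FF /cauchyP Fc.
have cvg_proj (V : hilbertType R) (f : hprod H1 H2 -> V) :
    (forall p q, `|f p - f q| <= `|p - q|) -> cvg (f @ F).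
  move=> fle; apply: cauchy_cvg; apply/cauchyP => e e0.
  have [x Fx] := Fc _ e0; exists (f x).
  have sub : ball x e `<=` f @^-1` ball (f x) e.
    move=> y; rewrite -ball_normE /preimage/= -ball_normE /=.
    exact: le_lt_trans.
  exact: (@filterS _ F _ _ _ sub Fx).
have c1 : cvg (fst @ F).
  by apply: cvg_proj => p q; exact: (fst_le_hprod_norm (p - q)).
have c2 : cvg (snd @ F).
  by apply: cvg_proj => p q; exact: (snd_le_hprod_norm (p - q)).
apply/cvg_ex; exists ((lim (fst @ F), lim (snd @ F)) : hprod H1 H2).
apply/cvgrPdist_lt => e e0; have e20 : 0 < e / 2 by rewrite divr_gt0.
have F1 := (cvgrPdist_lt _ _).1 c1 _ e20.
have F2 := (cvgrPdist_lt _ _).1 c2 _ e20.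
near=> p; rewrite [ltRHS]splitr.
apply: le_lt_trans (hprod_norm_leD _) (ltrD _ _).
  by near: p; exact: F1.
by near: p; exact: F2.
Unshelve. all: by end_near. Qed.

HB.instance Definition _ := Uniform_isComplete.Build (hprod H1 H2) hprod_complete.

Definition hprod_inner p q : R[i] := inner p.1 q.1 + inner p.2 q.2.

Lemma hprod_inner_bilinear :
  bilinear_for ( *%R) (@Num.conj R[i] \; *%R) hprod_inner.
Proof.
split=> [q a u v|p a u v]; rewrite /hprod_inner/=.
  by rewrite !linearPl mulrDr addrACA.
by rewrite !linearPr/= mulrDr addrACA.
Qed.

HB.instance Definition _ := @bilinear_isBilinear.Build R[i] (hprod H1 H2)
  (hprod H1 H2) R[i] ( *%R) (@Num.conj R[i] \; *%R) hprod_inner hprod_inner_bilinear.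

Lemma hprod_inner_herm p q :
  hprod_inner p q = (-1) ^+ false * Num.conj (hprod_inner q p).
Proof.
rewrite expr0 mul1r /hprod_inner rmorphD/=.
by rewrite (hermC _ p.1) (hermC _ p.2) !expr0 !mul1r.
Qed.

HB.instance Definition _ := @isHermitianSesquilinear.Build R[i] (hprod H1 H2)
  false (@Num.conj R[i]) hprod_inner hprod_inner_herm.

Lemma hprod_inner_norm p : hprod_inner p p = `|p| ^+ 2.
Proof. by rewrite hprod_normE hprod_norm_sqr /hprod_inner !inner_norm. Qed.

Lemma hprod_inner_gt0 p : p != 0 -> 0 < hprod_inner p p.
Proof. by move=> p0; rewrite hprod_inner_norm exprn_gt0 ?normr_gt0. Qed.

HB.instance Definition _ := @isDotProduct.Build R[i] (hprod H1 H2)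
  hprod_inner hprod_inner_gt0.

HB.instance Definition _ := @NormedModule_isHilbert.Build R (hprod H1 H2)
  hprod_inner hprod_inner_norm.

End HilbertProduct.

(* An operator is a total function of which only the values on [dom] matter. *)
Record linop (R : realType) (U V : lmodType R[i]) := LinOp {
  dom : set U ;
  linop_fun :> U -> V ;
  dom_submod : submod_closed [in dom] ;
  linop_linear : forall a : R[i], {in dom &, forall u v,
    linop_fun (a *: u + v) = a *: linop_fun u + linop_fun v}
}.

Section Operators.
Variables (R : realType) (H1 H2 : hilbertType R).
Variables (A1 : linop (hprod H1 H2) H1) (A21 : linop H1 H2).
Variable S : {linear H2 -> H2}.

Definition Aext_dom : set (hprod H1 H2) :=
  [set h | h \in dom A1 /\ h.1 \in dom A21].

Definition Aext_fun (h : hprod H1 H2) : hprod H1 H2 := (A1 h, A21 h.1).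

Lemma Aext_dom_submod : submod_closed [in Aext_dom].
Proof.
have [z1 l1] := dom_submod A1; have [z2 l2] := dom_submod A21.
split; first by apply/mem_set; split.
move=> a u v /set_mem[u1 u2] /set_mem[v1 v2]; apply/mem_set; split.
  exact: l1.
exact: l2.
Qed.

Lemma Aext_linear (a : R[i]) : {in Aext_dom &, forall u v,
  Aext_fun (a *: u + v) = a *: Aext_fun u + Aext_fun v}.
Proof.
move=> u v /set_mem[u1 u2] /set_mem[v1 v2].
by rewrite /Aext_fun (linop_linear _ u1 v1) /= (linop_linear _ u2 v2).
Qed.

Definition A_ext : linop (hprod H1 H2) (hprod H1 H2) :=
  LinOp Aext_dom_submod Aext_linear.

Definition AS_dom : set H1 :=
  [set h | h \in dom A21 /\ ((h, S (A21 h)) : hprod H1 H2) \in dom A1].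

Definition AS_fun (h : H1) : H1 := A1 (h, S (A21 h)).

Let AS_arg (a : R[i]) (u v : H1) : u \in dom A21 -> v \in dom A21 ->
  ((a *: u + v, S (A21 (a *: u + v))) : hprod H1 H2) =
  a *: ((u, S (A21 u)) : hprod H1 H2) + (v, S (A21 v)).
Proof. by move=> u2 v2; rewrite (linop_linear _ u2 v2) linearP. Qed.

Lemma AS_dom_submod : submod_closed [in AS_dom].
Proof.
have [z1 l1] := dom_submod A1; have [z2 l2] := dom_submod A21.
have A0 : A21 0 = 0.
  have := linop_linear (-1) z2 z2.
  by rewrite addr0 scaler0 scaleN1r addNr.
split.
  by apply/mem_set; split => //; rewrite A0 linear0; exact: z1.
move=> a u v /set_mem[u1 u2] /set_mem[v1 v2]; apply/mem_set; split.
  exact: l2.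
by rewrite AS_arg//; exact: l1.
Qed.

Lemma AS_linear (a : R[i]) : {in AS_dom &, forall u v,
  AS_fun (a *: u + v) = a *: AS_fun u + AS_fun v}.
Proof.
move=> u v /set_mem[u1 u2] /set_mem[v1 v2].
by rewrite /AS_fun AS_arg// linop_linear.
Qed.

Definition A_S : linop H1 H1 := LinOp AS_dom_submod AS_linear.

End Operators.

Section OperatorProperties.
Variables (R : realType) (H : hilbertType R).

Definition bounded_operator (S : H -> H) : Prop :=
  exists M : R, forall h, `|S h| <= M%:C * `|h|.

Definition coercive (S : H -> H) : Prop :=
  exists2 nu : R, 0 < nu &
    forall h, nu%:C * `|h| ^+ 2 <= (complex.Re (inner h (S h)))%:C.

Definition dissipative (A : linop H H) : Prop :=
  forall h, h \in dom A -> complex.Re (inner (A h) h) <= 0.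

Definition point_spectrum (A : linop H H) : set R[i] :=
  [set lambda | exists h, [/\ h \in dom A, h != 0 & A h = lambda *: h]].

End OperatorProperties.

Definition imaginary_axis (R : realType) : set R[i] :=
  [set 'i%C * omega%:C | omega in [set: R]].
Arguments imaginary_axis R : clear implicits.

(* Main.v *)
Require Import Defs.
From mathcomp Require Import all_boot all_order all_algebra.
From mathcomp Require Import complex.
From mathcomp Require Import all_classical all_reals all_analysis.

Set Implicit Arguments.
Unset Strict Implicit.
Unset Printing Implicit Defensive.

Import Order.TTheory GRing.Theory Num.Theory.
Import numFieldNormedType.Exports.

Local Open Scope classical_set_scope.
Local Open Scope ring_scope.
Local Open Scope complex_scope.

(** Test dissipativity of [A_ext] on the vector [(v, S A21 v)], where [v] is an
eigenvector of [A_S] at the purely imaginary number [i omega]. The first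
components contribute [i omega |v|^2], whose real part vanishes
([Re_inner_imaginary_scale]), so that the whole of
[Re (A_ext (v, S A21 v) | (v, S A21 v))] is [Re (A21 v | S A21 v)]. Dissipativity
bounds this number by [0] from above, while coercivity of [S] bounds it from
below by [nu |A21 v|^2]. Hence [A21 v = 0] ([A_S_imaginary_eigen_A21]).

Consequently [S A21 v = 0] too, and [(v, S A21 v)] is just [(v, 0)], so
that [A_S v] and the first component of [A_ext (v, 0)] are both [A1 (v, 0)].
The equivalence of the three assertions is then a matter of reading off
components, and the inclusion of spectra follows because [(v, 0)] is nonzero
whenever [v] is. *)

(** Coercivity is strict away from the origin, so it detects zero vectors. *)
Lemma coercive_Re_le0_eq0 (R : realType) (H : hilbertType R) (S : H -> H)
    (h : H) :
  coercive S -> complex.Re (inner h (S h)) <= 0 -> h = 0.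
Proof.
move=> [nu nu_gt0 coerS] Re_le0; apply/eqP.
have nuC_gt0 : 0 < nu%:C :> R[i] by rewrite ltcR.
have : nu%:C * `|h| ^+ 2 <= 0 by apply: le_trans (coerS h) _; rewrite lecR.
rewrite pmulr_rle0// => sqr_le0; rewrite -normr_eq0 -sqrf_eq0.
by rewrite eq_le sqr_le0 exprn_ge0.
Qed.

(** A skew-adjoint scalar is neutral for dissipativity: [(h | h)] is real, and
an imaginary multiple of a real number has no real part. *)
Lemma Re_inner_imaginary_scale (R : realType) (H : hilbertType R) (omega : R)
    (h : H) :
  complex.Re (inner (('i%C * omega%:C) *: h) h) = 0.
Proof.
rewrite linearZl_LR /= inner_norm.
have : 0 <= `|h| ^+ 2 by rewrite exprn_ge0.
case: (_ ^+ 2) => a b; rewrite lecE /= => /andP[/eqP-> _].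
by rewrite !(mul0r, mulr0, mul1r, oppr0, addr0).
Qed.

(** The heart of the matter: on [(v, S A21 v)] dissipativity and coercivity give
opposite signs to [Re (A21 v | S A21 v)], which leaves no room for a nonzero
[A21 v]. *)
Lemma A_S_imaginary_eigen_A21 (R : realType) (H1 H2 : hilbertType R)
    (A1 : linop (hprod H1 H2) H1) (A21 : linop H1 H2) (S : {linear H2 -> H2})
    (omega : R) (v : H1) :
  coercive S -> dissipative (A_ext A1 A21) ->
  v \in dom (A_S A1 A21 S) ->
  A_S A1 A21 S v = ('i%C * omega%:C) *: v ->
  A21 v = 0.
Proof.
move=> S_coercive Aext_dissipative /set_mem[v21 v1] eigen_v.
apply: (coercive_Re_le0_eq0 S_coercive).
have lift_dom : ((v, S (A21 v)) : hprod H1 H2) \in dom (A_ext A1 A21).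
  by apply/mem_set; split.
have := Aext_dissipative _ lift_dom.
(* The first component of [A_ext] at the lifted vector is [A_S v] by definition. *)
rewrite [inner _ _]/(inner (A_S A1 A21 S v) v + inner (A21 v) (S (A21 v))).
by rewrite eigen_v raddfD /= Re_inner_imaginary_scale add0r.
Qed.

Theorem theorem3p2 (R : realType) (H1 H2 : hilbertType R)
    (H1_neq0 : exists h : H1, h != 0) (H2_neq0 : exists h : H2, h != 0)
    (A1 : linop (hprod H1 H2) H1) (A21 : linop H1 H2)
    (S : {linear H2 -> H2})
    (S_bounded : bounded_operator S) (S_coercive : coercive S)
    (Aext_dissipative : dissipative (A_ext A1 A21)) :
  (forall (omega : R) (v : H1),
    let v0 : hprod H1 H2 := (v, 0) in
    [<-> v \in dom (A_S A1 A21 S) /\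
           A_S A1 A21 S v = ('i%C * omega%:C) *: v;
         v0 \in dom (A_ext A1 A21) /\
           A_ext A1 A21 v0 = ('i%C * omega%:C) *: v0;
         [/\ v \in dom A21, A21 v = 0, v0 \in dom A1 &
             A1 v0 = ('i%C * omega%:C) *: v]]) /\
  point_spectrum (A_S A1 A21 S) `&` imaginary_axis R `<=`
    point_spectrum (A_ext A1 A21) `&` imaginary_axis R.
Proof.
have equiv (omega : R) (v : H1) : let v0 : hprod H1 H2 := (v, 0) in
    [<-> v \in dom (A_S A1 A21 S) /\
           A_S A1 A21 S v = ('i%C * omega%:C) *: v;
         v0 \in dom (A_ext A1 A21) /\
           A_ext A1 A21 v0 = ('i%C * omega%:C) *: v0;
         [/\ v \in dom A21, A21 v = 0, v0 \in dom A1 &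
             A1 v0 = ('i%C * omega%:C) *: v]].
  move=> v0; tfae.
  - move=> [vS eigen_v].
    have A21v := A_S_imaginary_eigen_A21 S_coercive Aext_dissipative vS eigen_v.
    have lift_v : ((v, S (A21 v)) : hprod H1 H2) = v0 by rewrite A21v linear0.
    have [v21 v1] := set_mem vS; rewrite lift_v in v1.
    split; first by apply/mem_set; split.
    have A1v : A1 v0 = ('i%C * omega%:C) *: v by rewrite -lift_v.
    rewrite /= /Aext_fun /= A21v A1v.
    by congr pair; rewrite scaler0.
  - move=> [/set_mem[v1 v21] [A1v A21v]].
    by split=> //; rewrite A21v scaler0.
  - move=> [v21 A21v v1 A1v].
    have lift_v : ((v, S (A21 v)) : hprod H1 H2) = v0 by rewrite A21v linear0.
    split; first by apply/mem_set; split; rewrite // lift_v.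
    by rewrite /= /AS_fun lift_v.
split=> // lambda [[v [vS v_neq0 eigen_v]] imag]; split=> //.
have [omega _ lambdaE] := imag; rewrite -lambdaE in eigen_v *.
have [v0_dom eigen_v0] := (equiv omega v 0%N 1%N).1 (conj vS eigen_v).
exists (v, 0); split=> //.
by apply: contraNneq v_neq0 => -[->].
Qed.
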